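(* Let $\mathcal{M}=X_0,X_1,\dots$ be a reversible Markov chain on a state space $\Sigma$ with a stationary distribution $\pi$ (reversibility being with respect to $\pi$), and let $\omega:\Sigma\to\mathbb{R}$ be an arbitrary real-valued labeling of the states. Suppose $X_0\sim\pi$. Then for every $\varepsilon>0$ and every fixed integer $k\geq 0$, the probability that $\omega(X_0)$ is an $\varepsilon$-outlier among the list $\omega(X_0),\omega(X_1),\dots,\omega(X_k)$ is at most $\sqrt{2\varepsilon}$.
   Context: A Markov chain on a (countable) state space $\Sigma$ is a time-homogeneous sequence $X_0,X_1,\dots$ of $\Sigma$-valued random variables, described by the distribution of $X_0$ and the transition probabilities $\Pr(X_1=\sigma_1\mid X_0=\sigma_0)$. A distribution $\pi$ is stationary if $X_0\sim\pi$ implies $X_1\sim\pi$. The chain is reversible (with respect to $\pi$) if, when started from $X_0\sim\pi$, for all $i,k$ the sequence $(X_i,X_{i+1},\dots,X_{i+k})$ has the same distribution as $(X_{i+k},X_{i+k-1},\dots,X_i)$. The chain is not assumed to be irreducible, aperiodic, or mixing, and $\omega$ need not have any relation to the transition probabilities. A real number $\alpha_0$ is an $\varepsilon$-outlier among $\alpha_0,\alpha_1,\dots,\alpha_k$ if there are at most $\varepsilon(k+1)$ indices $i\in\{0,1,\dots,k\}$ for which $\alpha_i\leq\alpha_0$ (the index $i=0$ is counted). *)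

(* Defs.v *)
From HB Require Import structures.
From mathcomp Require Import all_boot all_order all_algebra.
From mathcomp Require Import all_classical all_reals all_analysis.

Import Order.TTheory GRing.Theory Num.Theory.
Import numFieldNormedType.Exports.

#[export] Set Implicit Arguments.
#[export] Unset Strict Implicit.
#[export] Unset Printing Implicit Defensive.

Local Open Scope classical_set_scope.
Local Open Scope ring_scope.

(* Throughout, [Sigma] is meant to be a countable set carrying its discrete
   sigma-algebra; the main theorem assumes both properties. *)

Definition has_law {dS : measure_display} {Sigma : measurableType dS}
    {R : realType} {d : measure_display} {T : measurableType d}
    {P : probability T R} (X : {RV P >-> Sigma}) (mu : probability Sigma R)
    : Prop :=
  forall A : set Sigma, measurable A -> distribution P X A = mu A.

(* Markov property and time-homogeneity at once:
     Pr(X_(n+1) = s_(n+1) | X_0 = s_0, ..., X_n = s_n) = p s_n {s_(n+1)},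
   multiplied by the probability of the conditioning event, so that histories
   of probability 0 impose no constraint. *)
Definition markov_chain {dS : measure_display} {Sigma : measurableType dS}
    {R : realType} {d : measure_display} {T : measurableType d}
    {P : probability T R} (p : R.-pker Sigma ~> Sigma)
    (X : nat -> {RV P >-> Sigma}) : Prop :=
  forall (n : nat) (s : nat -> Sigma),
    P [set w | forall i, (i <= n.+1)%N -> X i w = s i] =
    (P [set w | forall i, (i <= n)%N -> X i w = s i] *
     p (s n) [set s n.+1])%E.

(* Stationarity and reversibility are properties of the transition kernel [p]
   and the distribution [pi]: "when started from X_0 ~ pi" is rendered by
   quantifying over all realizations of the chain with initial law [pi]. *)
Definition stationary {dS : measure_display} {Sigma : measurableType dS}
    {R : realType} (p : R.-pker Sigma ~> Sigma) (pi : probability Sigma R)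
    : Prop :=
  forall (d : measure_display) (T : measurableType d) (P : probability T R)
    (X : nat -> {RV P >-> Sigma}),
    markov_chain p X -> has_law (X 0%N) pi -> has_law (X 1%N) pi.

(* The events below are { (X_i, ..., X_(i+k)) \in B } and
   { (X_(i+k), ..., X_i) \in B }, for B in the product sigma-algebra. *)
Definition reversible {dS : measure_display} {Sigma : measurableType dS}
    {R : realType} (p : R.-pker Sigma ~> Sigma) (pi : probability Sigma R)
    : Prop :=
  forall (d : measure_display) (T : measurableType d) (P : probability T R)
    (X : nat -> {RV P >-> Sigma}),
    markov_chain p X -> has_law (X 0%N) pi ->
    forall (i k : nat) (B : set (k.+1.-tuple Sigma)), measurable B ->
      P [set w | B [tuple X (i + j)%N w | j < k.+1]] =
      P [set w | B [tuple X (i + (k - j))%N w | j < k.+1]].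

Definition outlier {R : realType} (eps : R) (k : nat) (a : nat -> R) : Prop :=
  (#|[set i : 'I_k.+1 | (a i <= a 0%N)%R]%SET|)%:R <= eps * k.+1%:R.

(* Main.v *)
Require Import Defs.
From HB Require Import structures.
From mathcomp Require Import all_boot all_order all_algebra.
From mathcomp Require Import all_classical all_reals all_analysis.
From mathcomp Require Import measurable_realfun zify lra.
Import Order.TTheory GRing.Theory Num.Theory.
Import numFieldNormedType.Exports.
Local Open Scope classical_set_scope.
Local Open Scope ring_scope.

(* Let N = eps (k + 1).  If X_j has at most N smaller-or-equal values among
   X_0, ..., X_j and at most N among X_j, ..., X_k, then it has at most 2 N among
   X_0, ..., X_k.  Given X_j = s, past and future are independent, the
   future is the chain started at s, and by reversibility so is the past; so, with a(s) the
   probability that X_0 = s is low (rank at most N) among X_0, ..., X_k,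
     P (X_j = s has rank at most 2 N) >= a(s)^2 / pi(s).
   Summing over s, Cauchy-Schwarz bounds P (X_j has rank at most 2 N) from below by
   the square of the probability in question.  Deterministically at most 2 N
   indices j have rank at most 2 N, so summing over j = 0, ..., k gives the bound. *)

(** * Events determined by finitely many coordinates over a countable state space *)

(** Events live on infinite sequences, so that shifting, truncating and reversing a window is mere
    reindexing, without casts between tuple types. Index [n] is included: [n + 1] coordinates
    matter. *)
Definition depends_on_prefix (S : Type) (n : nat) (Q : set (nat -> S)) : Prop :=
  forall x y, (forall i, (i <= n)%N -> x i = y i) -> Q x -> Q y.

(** Finite words over a countable alphabet are countable. The code cuts any event into countably
    many pieces on which the prefix is constant. *)
Lemma prefix_code (S : Type) (n : nat) : countable [set: S] ->
  exists c : (nat -> S) -> nat,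
    forall x y, c x = c y <-> forall i, (i <= n)%N -> x i = y i.
Proof.
move=> /countable_injP[f f_inj].
exists (fun x => choice.pickle [seq f (x i) | i <- iota 0 n.+1]) => x y; split.
- move=> /(pcan_inj choice.pickleK)/eq_in_map fxy i lein.
  by apply: f_inj; rewrite ?inE// fxy// mem_iota.
- move=> xy; congr (choice.pickle _); apply/eq_in_map => i.
  by rewrite mem_iota => /andP[_ lein]; rewrite xy.
Qed.

Lemma measure_fibers {R : realType} {d : measure_display} {T : measurableType d}
    (mu : {measure set T -> \bar R}) (G : set T) (c : T -> nat) :
  (forall n, measurable (G `&` [set w | c w = n])) ->
  mu G = (\sum_(n <oo) mu (G `&` [set w | c w = n]))%E.
Proof.
move=> mGc; have GE : G = \bigcup_n (G `&` [set w | c w = n]).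
  by apply/seteqP; split=> w => [Gw|[n _ []//]]; exists (c w).
rewrite {1}GE measure_semi_bigcup//; last exact: bigcup_measurable.
apply/trivIsetP => i j _ _ ij; apply/seteqP; split=> // w [[_ ci] [_ cj]].
by move: ij; rewrite -ci -cj eqxx.
Qed.

Lemma measurable_cylinder {d dS : measure_display} {T : measurableType d}
    {Sigma : measurableType dS} (X : nat -> T -> Sigma) (n : nat)
    (s : nat -> Sigma) :
  (forall i, measurable (X i @^-1` [set s i])) ->
  measurable [set w | forall i, (i <= n)%N -> X i w = s i].
Proof.
move=> mX; rewrite (_ : mkset _ = \bigcap_(i in `I_n.+1) (X i @^-1` [set s i])).
  by apply: bigcap_measurable => //; exists 0%N.
by apply/seteqP; split.
Qed.

(** On each fiber of the prefix code the event is either a whole cylinder or empty, so it is a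
    countable union of measurable sets. *)
Lemma measurable_prefix_event {d dS : measure_display} {T : measurableType d}
    {Sigma : measurableType dS} (X : nat -> T -> Sigma) (n : nat)
    (Q : set (nat -> Sigma)) :
  countable [set: Sigma] ->
  (forall i s, measurable (X i @^-1` [set s])) -> depends_on_prefix n Q ->
  measurable [set w | Q (X ^~ w)].
Proof.
move=> Sc mX Qn; have [c cE] := prefix_code n Sc.
rewrite (_ : mkset _ = \bigcup_m [set w | Q (X ^~ w) /\ c (X ^~ w) = m]); last first.
  by apply/seteqP; split=> w => [Qw|[m _ []//]]; exists (c (X ^~ w)).
apply: bigcup_measurable => m _.
have [[x [Qx cx]]|no] := pselect (exists x, Q x /\ c x = m).
  rewrite (_ : mkset _ = [set w | forall i, (i <= n)%N -> X i w = x i]).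
    exact: measurable_cylinder.
  apply/seteqP; split=> w /=; first by move=> [_]; rewrite -cx => /cE.
  by move=> Xx; split; [apply: Qn Qx => i /Xx | rewrite -cx; apply/cE].
rewrite (_ : mkset _ = set0)//; apply/seteqP; split=> // w Qw.
by apply: no; exists (X ^~ w).
Qed.

(** The product sigma-algebra is discrete here too, which makes [reversible] applicable to every set
    of tuples. *)
Lemma measurable_discrete_tuple {dS : measure_display}
    {Sigma : measurableType dS} (n : nat) (B : set (n.+1.-tuple Sigma)) :
  countable [set: Sigma] -> (forall A : set Sigma, measurable A) -> measurable B.
Proof.
move=> Sc Sm; pose Q (x : nat -> Sigma) := B [tuple x i | i < n.+1].
have Qn : depends_on_prefix n Q.
  move=> x y xy; rewrite /Q (_ : [tuple x i | i < n.+1] = [tuple y i | i < n.+1])//.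
  by apply: eq_from_tnth => i; rewrite !tnth_mktuple xy// -ltnS.
pose X i (t : n.+1.-tuple Sigma) := tnth t (inord i).
rewrite (_ : B = [set t | Q (X ^~ t)]).
  apply: measurable_prefix_event Qn => // i s.
  by rewrite -[X in measurable X]setTI; apply: measurable_tnth.
apply/funext => t; rewrite /Q /X /= (_ : [tuple _ | i < _] = t)//.
by apply: eq_from_tnth => i; rewrite tnth_mktuple inord_val.
Qed.

(** * Ranks in a finite list *)

Definition rank (R : realType) (k j : nat) (a : nat -> R) : nat :=
  (\sum_(0 <= i < k.+1) (a i <= a j)%R)%N.

Lemma outlier_rank (R : realType) (eps : R) (k : nat) (a : nat -> R) :
  outlier eps k a <-> (rank k 0 a)%:R <= eps * k.+1%:R.
Proof.
rewrite /outlier /rank -sum1_card big_mkord big_mkcond /=.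
by under eq_bigr => i _ do rewrite inE.
Qed.

Lemma eq_rank (R : realType) (k j : nat) (a b : nat -> R) : (j <= k)%N ->
  (forall i, (i <= k)%N -> a i = b i) -> rank k j a = rank k j b.
Proof.
move=> lejk ab; rewrite /rank !big_mkord; apply: eq_bigr => i _.
by rewrite !ab// -ltnS.
Qed.

Lemma rank_le (R : realType) (m k j : nat) (a : nat -> R) :
  (m <= k)%N -> (rank m j a <= rank k j a)%N.
Proof.
by move=> lemk; rewrite /rank (big_cat_nat _ (n := m.+1) (p := k.+1))//= leq_addr.
Qed.

(** The list is cut at [j] and its first half is read backwards, so that [j] comes first in both
    halves. Index [j] is counted in both, hence only an inequality. *)
Lemma rank_split (R : realType) (k j : nat) (a : nat -> R) : (j <= k)%N ->
  (rank k j a <= rank j 0 (fun i => a (j - i)%N) +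
                 rank (k - j) 0 (fun i => a (j + i)%N))%N.
Proof.
move=> lejk; rewrite /rank (big_cat_nat _ (n := j) (p := k.+1))//=; last exact: leqW.
apply: leq_add.
  rewrite [leqRHS]big_nat_rev /= add0n [leqRHS]big_nat_recr//=.
  apply: leq_trans (leq_addr _ _); rewrite !big_mkord; apply: leq_sum => i _.
  by rewrite subn0 subSS subKn// ltnW.
rewrite -[X in (\sum_(X <= _ < _) _)%N]add0n big_addn subSn// addn0.
by apply: leq_sum => i _; rewrite addnC.
Qed.

(** Among the indices of rank at most [N], let [j] have the largest value. All of them are counted
    in the rank of [j], so there are at most [N] of them. *)
Lemma card_low_ranks (R : realType) (k : nat) (a : nat -> R) (N : R) : 0 <= N ->
  (\sum_(0 <= j < k.+1) ((rank k j a)%:R <= N)%R)%N%:R <= N.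
Proof.
move=> N0; rewrite big_mkord.
set low := fun j : 'I_k.+1 => (rank k j a)%:R <= N.
have [j0 low_j0|no_low] := pickP low; last first.
  by rewrite big1// => j _; have := no_low j; rewrite /low => ->.
case: (@arg_maxP _ _ _ j0 low (fun j => a j) low_j0) => j low_j jmax.
apply: le_trans low_j; rewrite ler_nat /rank big_mkord; apply: leq_sum => i _.
by have [/jmax /= ->|] := boolP ((rank k i a)%:R <= N).
Qed.

(** * Measurability and time reversal for the chain *)

Section reversible_chain.
Context (R : realType) (dS : measure_display) (Sigma : measurableType dS).
Hypothesis Sigma_countable : countable [set: Sigma].
Hypothesis Sigma_discrete : forall A : set Sigma, measurable A.
Context (p : R.-pker Sigma ~> Sigma) (pi : probability Sigma R)
  (d : measure_display) (T : measurableType d) (P : probability T R)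
  (X : nat -> {RV P >-> Sigma}).
Hypothesis p_reversible : reversible p pi.
Hypothesis X_markov : markov_chain p X.
Hypothesis X0_pi : has_law (X 0%N) pi.

Lemma measurable_chain_event (g : nat -> nat) (n : nat) (Q : set (nat -> Sigma)) :
  depends_on_prefix n Q -> measurable [set w | Q (fun i => X (g i) w)].
Proof.
by apply: (measurable_prefix_event (X := fun i => X (g i))) => // i s;
  apply: measurable_funPTI.
Qed.

Lemma window_reversal (i k : nat) (Q : set (nat -> Sigma)) :
  depends_on_prefix k Q ->
  P [set w | Q (fun j => X (i + j)%N w)] =
  P [set w | Q (fun j => X (i + (k - j))%N w)].
Proof.
move=> Qk; pose B : set (k.+1.-tuple Sigma) := [set t | Q (fun j => tnth t (inord j))].
have BE (x : nat -> Sigma) : B [tuple x j | j < k.+1] = Q x.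
  by apply/propext; split; apply: Qk => j lejk; rewrite tnth_mktuple inordK.
have := p_reversible X_markov X0_pi i
  (measurable_discrete_tuple B Sigma_countable Sigma_discrete).
under eq_set => w do rewrite (BE (fun j => X (i + j)%N w)).
by under [X in _ = P X -> _]eq_set => w do rewrite (BE (fun j => X (i + (k - j))%N w)).
Qed.

(** * Conditional independence of past and future *)

(** Each further step multiplies both sides by the same transition probability. Keeping the factor
    for [X 0 = s j] avoids division by a possibly null probability. *)
Lemma cylinder_split (j m : nat) (s : nat -> Sigma) :
  (P [set w | X 0%N w = s j] *
   P [set w | forall i, (i <= j + m)%N -> X i w = s i] =
   P [set w | forall i, (i <= j)%N -> X i w = s i] *
   P [set w | forall i, (i <= m)%N -> X i w = s (j + i)%N])%E.
Proof.
elim: m => [|m IH].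
  rewrite addn0 muleC; congr (_ * P _)%E; apply/seteqP; split=> w /=.
    by move=> X0 i; rewrite leqn0 => /eqP->; rewrite addn0.
  by move=> /(_ 0%N isT); rewrite addn0.
have /= := X_markov m (fun i => s (j + i)%N) => ->.
by rewrite muleA -IH addnS X_markov muleA.
Qed.

(** This is [cylinder_split] summed over the future windows that start at [s j] and satisfy [Q]. *)
Lemma prefix_future (j m : nat) (s : nat -> Sigma) (Q : set (nat -> Sigma)) :
  depends_on_prefix m Q ->
  (P [set w | X 0%N w = s j] *
   P [set w | (forall i, (i <= j)%N -> X i w = s i) /\
              Q (fun i => X (j + i)%N w)] =
   P [set w | forall i, (i <= j)%N -> X i w = s i] *
   P [set w | X 0%N w = s j /\ Q (fun i => X i w)])%E.
Proof.
move=> Qm; have [c cE] := prefix_code m Sigma_countable.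
set C := [set w | _ /\ Q (fun i => X (j + i)%N w)].
set D := [set w | _ /\ Q (fun i => X i w)].
(* A code fixes one future window: either it is excluded from both events, or both fibers are
   cylinders of the same sequence [s']. *)
have key n : C `&` [set w | c (fun i => X (j + i)%N w) = n] = set0 /\
             D `&` [set w | c (fun i => X i w) = n] = set0 \/
  exists s', (forall i, (i <= j)%N -> s' i = s i) /\
    C `&` [set w | c (fun i => X (j + i)%N w) = n] =
    [set w | forall i, (i <= j + m)%N -> X i w = s' i] /\
    D `&` [set w | c (fun i => X i w) = n] =
    [set w | forall i, (i <= m)%N -> X i w = s' (j + i)%N].
  have [[x [x0 Qx cx]]|no] := pselect (exists x, [/\ x 0%N = s j, Q x & c x = n]).
    (* Glue the past [s] and the future [x]; they agree at time [j] because [x 0 = s j]. *)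
    right; exists (fun i => if (i <= j)%N then s i else x (i - j)%N); split.
      by move=> i ->.
    have s'E i : (if (j + i <= j)%N then s (j + i)%N else x (j + i - j)%N) = x i.
      by rewrite addKn; case: i => [|i]; [rewrite addn0 leqnn|rewrite ifF//; lia].
    split; apply/seteqP; split => w /=.
    - move=> [[Xs QX]]; rewrite -cx => /cE Xx i leijm.
      case: ifPn => [/Xs//|]; rewrite -ltnNge => ltji.
      by rewrite -Xx; [congr (X _ w)|]; lia.
    - move=> Xs; have Xx i : (i <= m)%N -> X (j + i)%N w = x i.
        by move=> leim; rewrite Xs ?s'E// leq_add2l.
      split; last by rewrite /= -cx; apply/cE.
      split; last by apply: Qm Qx => i /Xx.
      by move=> i leij; rewrite Xs ?leij// (leq_trans leij)// leq_addr.
    - by move=> [[X0 QX]]; rewrite -cx => /cE Xx i leim; rewrite s'E Xx.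
    - move=> Xs; have Xx i : (i <= m)%N -> X i w = x i.
        by move=> leim; rewrite Xs ?s'E.
      split; last by rewrite /= -cx; apply/cE.
      by split; [rewrite Xx|apply: Qm Qx => i /Xx].
  left; split; apply/seteqP; split=> // w.
    move=> [[Xs QX] cX]; apply: no; exists (fun i => X (j + i)%N w).
    by split=> //; rewrite addn0 Xs.
  by move=> [[X0 QX] cX]; apply: no; exists (fun i => X i w).
have mC n : measurable (C `&` [set w | c (fun i => X (j + i)%N w) = n]).
  have [[-> _]//|[s' [_ [-> _]]]] := key n.
  by apply: (measurable_cylinder (X := X)) => i; apply: measurable_funPTI.
have mD n : measurable (D `&` [set w | c (fun i => X i w) = n]).
  have [[_ ->]//|[s' [_ [_ ->]]]] := key n.
  by apply: (@measurable_cylinder _ _ _ _ X m (fun i => s' (j + i)%N)) => i;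
    apply: measurable_funPTI.
rewrite (measure_fibers _ mC) (measure_fibers _ mD).
have m0 : measurable [set w | X 0%N w = s j].
  exact: (measurable_funPTI (X 0%N) (Sigma_discrete [set s j])).
have mj : measurable [set w | forall i, (i <= j)%N -> X i w = s i].
  by apply: (measurable_cylinder (X := X)) => i; apply: measurable_funPTI.
(* The constant factors are exhibited as finite reals so that they can move inside the series. *)
rewrite -(fineK (fin_num_measure P _ m0)) -(fineK (fin_num_measure P _ mj)).
rewrite -!nneseriesZl//; apply: eq_eseriesr => n _.
rewrite !fineK ?fin_num_measure//.
have [[-> ->]|[s' [s's [-> ->]]]] := key n; first by rewrite !measure0 !mule0.
rewrite -(s's j)// cylinder_split; congr (P _ * _)%E; apply/seteqP.
by split=> w Xs i leij; rewrite Xs// s's.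
Qed.

(** This is [prefix_future] summed over the pasts that end at [s] and satisfy [Q1]. *)
Lemma past_future (j m : nat) (s : Sigma) (Q1 Q2 : set (nat -> Sigma)) :
  depends_on_prefix j Q1 -> depends_on_prefix m Q2 ->
  (P [set w | X 0%N w = s] *
   P [set w | X j w = s /\ Q1 (fun i => X i w) /\ Q2 (fun i => X (j + i)%N w)] =
   P [set w | X j w = s /\ Q1 (fun i => X i w)] *
   P [set w | X 0%N w = s /\ Q2 (fun i => X i w)])%E.
Proof.
move=> Q1j Q2m; have [c cE] := prefix_code j Sigma_countable.
set C := [set w | _ /\ _ /\ Q2 (fun i => X (j + i)%N w)].
set D := [set w | _ /\ Q1 (fun i => X i w)].
(* Fixing the code of the past turns the fiber of [D] into a cylinder and that of [C] into the event
   treated by [prefix_future]. *)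
have key n : C `&` [set w | c (fun i => X i w) = n] = set0 /\
             D `&` [set w | c (fun i => X i w) = n] = set0 \/
  exists x, x j = s /\
    C `&` [set w | c (fun i => X i w) = n] =
    [set w | (forall i, (i <= j)%N -> X i w = x i) /\
             Q2 (fun i => X (j + i)%N w)] /\
    D `&` [set w | c (fun i => X i w) = n] =
    [set w | forall i, (i <= j)%N -> X i w = x i].
  have [[x [xj Qx cx]]|no] := pselect (exists x, [/\ x j = s, Q1 x & c x = n]).
    right; exists x; split=> //; split; apply/seteqP; split=> w /=.
    - by move=> [[_ [_ QX]]]; rewrite -cx => /cE.
    - move=> [Xx QX]; split; last by rewrite /= -cx; apply/cE.
      by split; [rewrite Xx|split=> //; apply: Q1j Qx => i /Xx].
    - by move=> [[_ _]]; rewrite -cx => /cE.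
    - move=> Xx; split; last by rewrite /= -cx; apply/cE.
      by split; [rewrite Xx|apply: Q1j Qx => i /Xx].
  left; split; apply/seteqP; split=> // w.
    by move=> [[Xj [QX _]] cX]; apply: no; exists (fun i => X i w).
  by move=> [[Xj QX] cX]; apply: no; exists (fun i => X i w).
have mC n : measurable (C `&` [set w | c (fun i => X i w) = n]).
  have [[-> _]//|[x [_ [-> _]]]] := key n.
  apply: (@measurable_chain_event id (j + m) (fun y =>
    (forall i, (i <= j)%N -> y i = x i) /\ Q2 (fun i => y (j + i)%N))).
  move=> y z yz [yx Q2y]; split; last first.
    by apply: Q2m Q2y => i leim; rewrite yz// leq_add2l.
  by move=> i leij; rewrite -yz ?yx// (leq_trans leij)// leq_addr.
have mD n : measurable (D `&` [set w | c (fun i => X i w) = n]).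
  have [[_ ->]//|[x [_ [_ ->]]]] := key n.
  by apply: (measurable_cylinder (X := X)) => i; apply: measurable_funPTI.
rewrite (measure_fibers _ mC) (measure_fibers _ mD) [RHS]muleC.
have m0 : measurable [set w | X 0%N w = s].
  exact: (measurable_funPTI (X 0%N) (Sigma_discrete [set s])).
have mQ2 : measurable [set w | X 0%N w = s /\ Q2 (fun i => X i w)].
  apply: (@measurable_chain_event id m (fun x => x 0%N = s /\ Q2 x)).
  by move=> x y xy [x0 Q2x]; split; [rewrite -xy|apply: Q2m Q2x].
rewrite -(fineK (fin_num_measure P _ m0)) -(fineK (fin_num_measure P _ mQ2)).
rewrite -!nneseriesZl//; apply: eq_eseriesr => n _.
rewrite !fineK ?fin_num_measure//.
have [[-> ->]|[x [<- [-> ->]]]] := key n; first by rewrite !measure0 !mule0.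
by rewrite (prefix_future _ _ Q2m) muleC.
Qed.

(** * Lower bound for the probability of low rank at time [j] *)

Lemma measurable_rank_event (omega : Sigma -> R) (g : nat -> nat) (k j : nat) (N : R) :
  (j <= k)%N ->
  measurable [set w | (rank k j (fun i => omega (X (g i) w)))%:R <= N].
Proof.
move=> lejk; apply: (@measurable_chain_event g k
  (fun x => (rank k j (fun i => omega (x i)))%:R <= N)) => x y xy.
by rewrite (@eq_rank _ k j _ (fun i => omega (y i)))// => i leik; rewrite xy.
Qed.

(* The Cauchy-Schwarz inequality over the states s is used in its linearized form
   2 c a <= a^2 / q + c^2 q, with q = pi(s) and later c the total probability of low
   rank: each term can then be summed separately. *)
Lemma low_rank_fiber (omega : Sigma -> R) (k j : nat) (N c : R) (s : Sigma) :
  (j <= k)%N -> 0 <= c ->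
  ((2 * c)%:E *
     P [set w | X 0%N w = s /\ ((rank k 0 (fun i => omega (X i w)))%:R <= N)%R] <=
   P [set w | X j w = s /\ ((rank k j (fun i => omega (X i w)))%:R <= 2 * N)%R] +
   (c ^+ 2)%:E * P [set w | X 0%N w = s])%E.
Proof.
move=> lejk c0.
pose low n (x : nat -> Sigma) := (rank n 0 (fun i => omega (x i)))%:R <= N.
have low_prefix n : depends_on_prefix n (low n).
  move=> x y xy; rewrite /low (@eq_rank _ n 0 _ (fun i => omega (y i)))// => i lein.
  by rewrite xy.
have low_prefix_at n : depends_on_prefix n (fun x => x 0%N = s /\ low n x).
  by move=> x y xy [x0 lx]; split; [rewrite -xy|apply: low_prefix lx].
have rev_prefix : depends_on_prefix j (fun x => low j (fun i => x (j - i)%N)).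
  by move=> x y xy; apply: low_prefix => i _; rewrite xy// leq_subr.
have mX i : measurable [set w | X i w = s].
  exact: (measurable_funPTI (X i) (Sigma_discrete [set s])).
have mlow n : measurable [set w | X 0%N w = s /\ low n (fun i => X i w)].
  exact: (@measurable_chain_event id n _ (low_prefix_at n)).
have mpast : measurable
    [set w | X j w = s /\ low j (fun i => X (j - i)%N w)].
  apply: (@measurable_chain_event id j (fun x => x j = s /\ low j (fun i => x (j - i)%N))).
  by move=> x y xy [xj lx]; split; [rewrite -xy|apply: rev_prefix lx].
set O := [set w | X 0%N w = s /\ _].
set F := [set w | X j w = s /\ _].
have mF : measurable F.
  exact: (measurableI _ _ (mX j) (measurable_rank_event omega id (2 * N) lejk)).
(* Shortening the list can only lower the rank of its first entry. *)
have O_le n : (n <= k)%N -> (P O <= P [set w | X 0%N w = s /\ low n (fun i => X i w)])%E.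
  move=> lenk; apply: le_measure; rewrite ?inE//; first exact: (mlow k).
  move=> w [X0 lw]; split=> //; apply: le_trans lw.
  by rewrite ler_nat rank_le.
have cond := @past_future j (k - j) s _ _ rev_prefix (low_prefix (k - j)%N).
set C := [set w | _ /\ _ /\ low (k - j)%N _] in cond.
have mC : measurable C.
  apply: (@measurable_chain_event id k (fun x => x j = s /\
    low j (fun i => x (j - i)%N) /\ low (k - j)%N (fun i => x (j + i)%N))).
  move=> x y xy [xj [past future]]; split; first by rewrite -xy.
  split; first by apply: rev_prefix past => i leij; rewrite xy// (leq_trans leij).
  apply: low_prefix future => i lei; rewrite xy//.
  by rewrite -(subnKC lejk) leq_add2l.
(* Rank at most [N] on both sides of [j] gives rank at most [2 * N] by [rank_split]. *)
have C_le : (P C <= P F)%E.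
  apply: le_measure; rewrite ?inE// => w [Xj [past future]]; split=> //.
  have := rank_split (fun i => omega (X i w)) lejk.
  rewrite -(ler_nat R) natrD => /le_trans; apply.
  by rewrite mulr_natl mulr2n; apply: lerD.
(* Reversing the window from 0 to [j] turns the past seen from [j] into a future seen from 0. *)
have revE : P [set w | X j w = s /\ low j (fun i => X (j - i)%N w)] =
            P [set w | X 0%N w = s /\ low j (fun i => X i w)].
  by rewrite [RHS](window_reversal 0 (low_prefix_at j)) add0n subn0.
rewrite revE in cond.
have mO : measurable O := mlow k.
have := O_le _ (leq_subr j k); have := O_le _ lejk; move: cond C_le.
have : (P O <= P [set w | X 0%N w = s])%E by apply: le_measure; rewrite ?inE// => w [].
have : (0 <= P O)%E by []; have : (0 <= P F)%E by [].
rewrite -(fineK (fin_num_measure P _ mO)) -(fineK (fin_num_measure P _ mF)).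
rewrite -(fineK (fin_num_measure P _ mC)) -(fineK (fin_num_measure P _ (mX 0%N))).
rewrite -(fineK (fin_num_measure P _ (mlow j))).
rewrite -(fineK (fin_num_measure P _ (mlow (k - j)%N))).
rewrite -!EFinM. rewrite -EFinD !lee_fin.
(* Here [o], [f], [q] are the probabilities of [O], [F], [C]; [r] is that of [X 0 = s]; [a] and [b]
   are those of low rank from [s] over [j] and [k - j] steps. *)
move: (fine _) (fine _) (fine _) (fine _) (fine (P C)) (fine (P [set w | _]))
  => b a r o q f f0 o0 o_r [rq_ab] q_f o_a o_b.
have rf_oo : o ^+ 2 <= r * f.
  apply: le_trans (ler_wpM2l (le_trans o0 o_r) q_f); rewrite rq_ab expr2.
  exact: ler_pM.
move: (le_trans o0 o_r); rewrite le_eqVlt => /predU1P[r0|r_gt0].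
  have -> : o = 0 by apply: le_anti; rewrite o0 r0 o_r.
  by rewrite mulr0 -r0 mulr0 addr0.
(* After multiplication by [r]: [2 c o r <= o^2 + c^2 r^2 <= r f + c^2 r^2]. *)
rewrite -(ler_pM2l r_gt0); have := sqr_ge0 (o - c * r); nra.
Qed.

(** Sum [low_rank_fiber] over all states with [c] the probability of [O]: this yields
    [2 c^2 <= P F + c^2]. *)
Lemma low_rank_probability (omega : Sigma -> R) (k j : nat) (N : R) :
  (j <= k)%N ->
  (fine (P [set w | ((rank k 0 (fun i => omega (X i w)))%:R <= N)%R]) ^+ 2 <=
   fine (P [set w | ((rank k j (fun i => omega (X i w)))%:R <= 2 * N)%R]))%R.
Proof.
move=> lejk; set O := [set w | _]; set F := [set w | (_ <= 2 * N)%R].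
have mO : measurable O by exact: (measurable_rank_event omega id N (leq0n k)).
have mF : measurable F by exact: (measurable_rank_event omega id _ lejk).
have /countable_injP[f f_inj] := Sigma_countable.
have mfib G i n : measurable G -> measurable (G `&` [set w | f (X i w) = n]).
  move=> mG; apply: measurableI => //.
  exact: (measurable_funPTI (X i) (Sigma_discrete (f @^-1` [set n]))).
set c := fine (P O).
have c0 : 0 <= c by exact: fine_ge0.
(* The total mass is kept as [P [set: T]] so that it splits over the states like the other two
   terms. *)
have : ((2 * c)%:E * P O <= P F + (c ^+ 2)%:E * P [set: T])%E.
  rewrite (measure_fibers P (fun n => mfib _ 0%N n mO)).
  rewrite (measure_fibers P (fun n => mfib _ j n mF)).
  rewrite (measure_fibers P (fun n => mfib _ 0%N n measurableT)).
  rewrite -!nneseriesZl// -nneseriesD//; last first.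
    by move=> n _ _; rewrite mule_ge0// lee_fin sqr_ge0.
  apply: lee_nneseries => [n _ _|n _]; first by rewrite mule_ge0// lee_fin mulr_ge0.
  (* A code of no state has an empty fiber, so its left-hand term is zero. *)
  have [[s fs]|no] := pselect (exists s, f s = n); last first.
    rewrite (_ : O `&` _ = set0) ?measure0 ?mule0; last first.
      by apply/seteqP; split=> // w [_ fn]; apply: no; exists (X 0%N w).
    by rewrite adde_ge0// mule_ge0// lee_fin sqr_ge0.
  have fE i w : (f (X i w) = n) = (X i w = s).
    by apply/propext; split=> [|->//]; rewrite -fs => /f_inj; apply; rewrite inE.
  have fibE G i : G `&` [set w | f (X i w) = n] = [set w | X i w = s /\ G w].
    by apply/seteqP; split=> w /=; rewrite fE => -[].
  rewrite !fibE (_ : [set w | _ /\ [set: T] w] = [set w | X 0%N w = s]).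
    exact: low_rank_fiber.
  by apply/seteqP; split=> w // [].
rewrite probability_setT -[P O](fineK (fin_num_measure P _ mO)).
rewrite -[P F](fineK (fin_num_measure P _ mF)) -/c -!EFinM -EFinD lee_fin.
nra.
Qed.

(** * Expected number of low ranks, and the bound on outliers *)

(** The sum is the expected number of indices of rank at most [N], and [card_low_ranks] bounds that
    number pointwise. *)
Lemma sum_low_rank_probability (omega : Sigma -> R) (k : nat) (N : R) : 0 <= N ->
  \sum_(j < k.+1) fine (P [set w | ((rank k j (fun i => omega (X i w)))%:R <= N)%R])
  <= N.
Proof.
move=> N0; pose F (j : 'I_k.+1) := [set w | ((rank k j (fun i => omega (X i w)))%:R <= N)%R].
have mF j : measurable (F j).
  by apply: (measurable_rank_event omega id); rewrite -ltnS.
rewrite -lee_fin -sumEFin.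
under eq_bigr => j _.
  rewrite fineK; last by apply: fin_num_measure; exact: (mF j).
  rewrite -[X in P X]setIT -(integral_indic P measurableT (mF j)).
  over.
rewrite -ge0_integral_sum//; last first.
  by move=> j; apply/measurable_EFinP; exact: measurable_indic.
apply: (@le_trans _ _ (\int[P]_(x in [set: T]) (cst N%:E x))%E); last first.
  rewrite integral_cst// -[leRHS]mule1.
  by apply: lee_wpmul2l; [rewrite lee_fin|exact: probability_le1].
apply: ge0_le_integral => //.
- by move=> w _; apply: sume_ge0 => j _; rewrite lee_fin.
- apply: emeasurable_sum => j; apply/measurable_EFinP; exact: measurable_indic.
move=> w _; rewrite sumEFin lee_fin.
apply: le_trans (card_low_ranks k (fun i => omega (X i w)) N0).
rewrite big_mkord natr_sum; apply: ler_sum => j _; rewrite indicE /F.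
by case: (boolP (w \in _)) => [/set_mem /= ->|_].
Qed.

End reversible_chain.

Theorem theoremI1 (R : realType)
  (dS : measure_display) (Sigma : measurableType dS)
  (Sigma_countable : countable [set: Sigma])
  (Sigma_discrete : forall A : set Sigma, measurable A)
  (p : R.-pker Sigma ~> Sigma) (pi : probability Sigma R)
  (p_stationary : stationary p pi) (p_reversible : reversible p pi)
  (omega : Sigma -> R)
  (d : measure_display) (T : measurableType d) (P : probability T R)
  (X : nat -> {RV P >-> Sigma})
  (X_markov : markov_chain p X) (X0_pi : has_law (X 0%N) pi)
  (eps : R) (eps_gt0 : 0 < eps) (k : nat) :
  (P [set w | outlier eps k (fun i => omega (X i w))] <=
   (Num.sqrt (2 * eps))%:E)%E.
Proof.
pose N := eps * k.+1%:R.
rewrite (_ : mkset _ = [set w | (rank k 0 (fun i => omega (X i w)))%:R <= N]);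
  last first.
  by apply/funext => w; apply/propext; exact: outlier_rank.
set O := mkset _.
have mO : measurable O.
  exact: (measurable_rank_event Sigma_countable Sigma_discrete X omega id N (leq0n k)).
rewrite -(fineK (fin_num_measure P _ mO)) lee_fin.
have O0 : 0 <= fine (P O) by exact: fine_ge0.
have N0 : 0 <= 2 * N by rewrite !mulr_ge0// ltW.
have k_gt0 : (0 : R) < k.+1%:R by [].
(* Adding [low_rank_probability] over the [k + 1] indices gives [(k + 1) (P O)^2 <= 2 N], where
   [N = eps (k + 1)]. *)
have O2 : fine (P O) ^+ 2 <= 2 * eps.
  rewrite -(ler_pM2r k_gt0) -[leRHS]mulrA -/N.
  apply: le_trans (sum_low_rank_probability Sigma_countable Sigma_discrete X omega k N0).
  rewrite -[X in _ ^+ 2 * X%:R]card_ord mulr_natr -sumr_const.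
  apply: ler_sum => j _.
  by apply: (low_rank_probability Sigma_countable Sigma_discrete p_reversible
               X_markov X0_pi); rewrite -ltnS.
by rewrite -(ger0_norm O0) -sqrtr_sqr ler_wsqrtr.
Qed.
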